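(* Let $\mathbb{k}$ be a field, let $\mathcal{A}$ be a simplicial $\mathbb{k}$-algebra, let $\mathcal{B}$ and $\mathcal{C}$ be simplicial left modules over $\mathcal{A}$, and let $\mathcal{M}$ be a cosimplicial left module over $\mathcal{A}$. If there exists a presimplicial homotopy equivalence $f:\mathcal{B}\longrightarrow\mathcal{C}$, then $$\mathrm{H}^\bullet(\mathrm{Hom}_{\mathcal{A}}(\mathcal{B},\mathcal{M}))\cong \mathrm{H}^\bullet(\mathrm{Hom}_{\mathcal{A}}(\mathcal{C},\mathcal{M})),$$ that is, $\mathrm{H}^n(\mathrm{Hom}_{\mathcal{A}}(\mathcal{B},\mathcal{M}))\cong \mathrm{H}^n(\mathrm{Hom}_{\mathcal{A}}(\mathcal{C},\mathcal{M}))$ as $\mathbb{k}$-vector spaces for every $n\geq 0$.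
   Context: Throughout, $\mathbb{k}$ is a field and all $\mathbb{k}$-algebras are associative with multiplicative unit (not necessarily commutative). Simplicial $\mathbb{k}$-algebra: a collection of $\mathbb{k}$-algebras $\mathcal{A}=\{\mathcal{A}_n\}_{n\ge 0}$ with $\mathbb{k}$-algebra morphisms $\delta_i^{\mathcal{A}}:\mathcal{A}_n\to\mathcal{A}_{n-1}$ ($n\ge 1$) and $\sigma_i^{\mathcal{A}}:\mathcal{A}_n\to\mathcal{A}_{n+1}$ ($n\ge 0$), $0\le i\le n$, satisfying the simplicial identities: $\delta_i\delta_j=\delta_{j-1}\delta_i$ if $i<j$; $\sigma_i\sigma_j=\sigma_{j+1}\sigma_i$ if $i\le j$; $\delta_i\sigma_j=\sigma_{j-1}\delta_i$ if $i<j$; $\delta_i\sigma_j=\mathrm{id}$ if $i=j$ or $i=j+1$; $\delta_i\sigma_j=\sigma_j\delta_{i-1}$ if $i>j+1$. Simplicial left module over $\mathcal{A}$: a simplicial $\mathbb{k}$-vector space $\mathcal{B}=\{\mathcal{B}_n\}_{n\ge0}$ (with $\mathbb{k}$-linear maps $\delta_i^{\mathcal{B}},\sigma_i^{\mathcal{B}}$ satisfying the same simplicial identities) together with a left $\mathcal{A}_n$-module structure on each $\mathcal{B}_n$ such that $\delta_i^{\mathcal{B}}(ab)=\delta_i^{\mathcal{A}}(a)\delta_i^{\mathcal{B}}(b)$ and $\sigma_i^{\mathcal{B}}(ab)=\sigma_i^{\mathcal{A}}(a)\sigma_i^{\mathcal{B}}(b)$ for all $a\in\mathcal{A}_n$,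 $b\in\mathcal{B}_n$, $0\le i\le n$. Cosimplicial left module over $\mathcal{A}$: a cosimplicial $\mathbb{k}$-vector space $\mathcal{M}=\{\mathcal{M}^n\}_{n\ge0}$, with $\mathbb{k}$-linear cofaces $\delta^i_{\mathcal{M}}:\mathcal{M}^n\to\mathcal{M}^{n+1}$ ($0\le i\le n+1$) and codegeneracies $\sigma^i_{\mathcal{M}}:\mathcal{M}^{n+1}\to\mathcal{M}^{n}$ ($0\le i\le n$) satisfying the usual cosimplicial identities, together with a left $\mathcal{A}_n$-module structure on each $\mathcal{M}^n$ such that $\delta^i_{\mathcal{M}}(\delta_i^{\mathcal{A}}(a)m)=a\,\delta^i_{\mathcal{M}}(m)$ for all $a\in\mathcal{A}_{n+1}$, $m\in\mathcal{M}^n$, and $\sigma^i_{\mathcal{M}}(\sigma_i^{\mathcal{A}}(a)m)=a\,\sigma^i_{\mathcal{M}}(m)$ for all $a\in\mathcal{A}_{n}$, $m\in\mathcal{M}^{n+1}$. Presimplicial morphism $f:\mathcal{B}\to\mathcal{C}$ of simplicial left modules over $\mathcal{A}$: a family of $\mathcal{A}_n$-module morphisms $f_n:\mathcal{B}_n\to\mathcal{C}_n$ ($n\ge0$) such that $f_{n-1}\delta_i^{\mathcal{B}}=\delta_i^{\mathcal{C}}f_n$ for all $n\ge1$ and $0\le i\le n$ (no compatibility with degeneracies is required). Identities $\mathrm{id}_{\mathcal{B}}$ and composites are taken degreewise. Presimplicial homotopy between presimplicial morphisms $f,g:\mathcal{B}\to\mathcal{C}$: a family of $\mathbb{k}$-linear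 maps $h_i:\mathcal{B}_n\to\mathcal{C}_{n+1}$, for $n\ge0$ and $0\le i\le n$, such that (i) $h_i(ab)=\sigma_i^{\mathcal{A}}(a)h_i(b)$ for all $a\in\mathcal{A}_n$, $b\in\mathcal{B}_n$; and (ii) on $\mathcal{B}_n$: $\delta_i^{\mathcal{C}}h_j=h_{j-1}\delta_i^{\mathcal{B}}$ for $i<j$; $\delta_i^{\mathcal{C}}h_i=\delta_i^{\mathcal{C}}h_{i-1}$ for $0<i\le n$; $\delta_i^{\mathcal{C}}h_j=h_j\delta_{i-1}^{\mathcal{B}}$ for $i>j+1$; $\delta_0^{\mathcal{C}}h_0=f_n$; $\delta_{n+1}^{\mathcal{C}}h_n=g_n$. Presimplicial homotopy equivalence: a presimplicial morphism $f:\mathcal{B}\to\mathcal{C}$ for which there exists a presimplicial morphism $g:\mathcal{C}\to\mathcal{B}$ such that there is a presimplicial homotopy between $gf$ and $\mathrm{id}_{\mathcal{B}}$ and a presimplicial homotopy between $fg$ and $\mathrm{id}_{\mathcal{C}}$. The cosimplicial $\mathbb{k}$-module $\mathrm{Hom}_{\mathcal{A}}(\mathcal{B},\mathcal{M})$: in degree $n$ it is $\mathrm{Hom}_{\mathcal{A}_n}(\mathcal{B}_n,\mathcal{M}^n)$, with cofaces $D^i(\varphi)=\delta^i_{\mathcal{M}}\circ\varphi\circ\delta_i^{\mathcal{B}}\in\mathrm{Hom}_{\mathcal{A}_{n+1}}(\mathcal{B}_{n+1},\mathcal{M}^{n+1})$ for $\varphi\in\mathrm{Hom}_{\mathcal{A}_n}(\mathcal{B}_n,\mathcal{M}^n)$,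 $0\le i\le n+1$, and codegeneracies $S^i(\varphi)=\sigma^i_{\mathcal{M}}\circ\varphi\circ\sigma_i^{\mathcal{B}}\in\mathrm{Hom}_{\mathcal{A}_{n}}(\mathcal{B}_{n},\mathcal{M}^{n})$ for $\varphi\in\mathrm{Hom}_{\mathcal{A}_{n+1}}(\mathcal{B}_{n+1},\mathcal{M}^{n+1})$, $0\le i\le n$. $\mathrm{H}^\bullet(\mathrm{Hom}_{\mathcal{A}}(\mathcal{B},\mathcal{M}))$ denotes the cohomology of the associated cochain complex with differential $\sum_{i=0}^{n+1}(-1)^iD^i$ from degree $n$ to degree $n+1$. *)

(* Defs.v *)
From HB Require Import structures.
From mathcomp Require Import all_boot all_algebra ring_quotient.
From mathcomp Require Import boolp.

Set Implicit Arguments.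
Unset Strict Implicit.
Unset Printing Implicit Defensive.

Import GRing.Theory.
Local Open Scope quotient_scope.
Local Open Scope ring_scope.

(* Associative unital k-algebra: a ring with a central ring morphism from k.
   MathComp's algType is built on nzRingType, which excludes the zero algebra;
   pzRingType does not. *)
Record kalgebra (k : fieldType) := KAlgebra {
  kalg_ring :> pzRingType;
  kalg_in : {rmorphism k -> kalg_ring};
  kalg_central : forall (c : k) (a : kalg_ring), kalg_in c * a = a * kalg_in c
}.

Record kalg_morphism (k : fieldType) (A B : kalgebra k) := KAlgMorphism {
  kalg_map :> {rmorphism A -> B};
  kalg_map_in : forall c : k, kalg_map (kalg_in A c) = kalg_in B c
}.

(* Restriction of scalars along k -> A. The k-vector space underlying an
   A-module is always this one. *)
Definition restr (k : fieldType) (A : kalgebra k) (V : lmodType A) : Type := V.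

Section Restr.
Variables (k : fieldType) (A : kalgebra k) (V : lmodType A).

HB.instance Definition _ := GRing.Zmodule.on (restr V).

Definition restr_scale (c : k) (v : restr V) : restr V :=
  kalg_in A c *: (v : V).

Fact restr_scaleA a b v :
  restr_scale a (restr_scale b v) = restr_scale (a * b) v.
Proof. by rewrite /restr_scale scalerA -rmorphM. Qed.

Fact restr_scale1 : left_id 1 restr_scale.
Proof. by move=> v; rewrite /restr_scale rmorph1 scale1r. Qed.

Fact restr_scaleDr : right_distributive restr_scale +%R.
Proof. by move=> a u v; rewrite /restr_scale scalerDr. Qed.

Fact restr_scaleDl v : {morph restr_scale^~ v : a b / a + b}.
Proof. by move=> a b; rewrite /restr_scale rmorphD scalerDl. Qed.

HB.instance Definition _ := GRing.Zmodule_isLmodule.Build k (restr V)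
  restr_scaleA restr_scale1 restr_scaleDr restr_scaleDl.

Lemma restr_scaleE (c : k) (v : restr V) :
  c *: v = kalg_in A c *: (v : V) :> V.
Proof. by []. Qed.

End Restr.

Lemma linear_ext (R : pzRingType) (U V : lmodType R) (f g : {linear U -> V}) :
  f =1 g -> f = g.
Proof.
case: f g => [f [[f1] [f2]]] [g [[g1] [g2]]] /= /funext fg.
by subst g; congr GRing.Linear.Pack; congr GRing.Linear.Class;
  [congr GRing.isNmodMorphism.Axioms_ | congr GRing.isScalable.Axioms_];
  exact: Prop_irrelevance.
Qed.

Definition homA (k : fieldType) (A : kalgebra k) (U V : lmodType A) : Type :=
  {linear U -> V}.

Section HomA.
Variables (k : fieldType) (A : kalgebra k) (U V : lmodType A).
Local Notation H := (homA U V).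
Implicit Types f g : {linear U -> V}.

HB.instance Definition _ := gen_eqMixin H.
HB.instance Definition _ := gen_choiceMixin H.

Definition homA_zero : H := (\0 : U -> V) : {linear U -> V}.
Definition homA_add (f g : {linear U -> V}) : H :=
  (f \+ g) : {linear U -> V}.
Definition homA_opp (f : {linear U -> V}) : H := (\- f) : {linear U -> V}.

Fact homA_addA : associative (homA_add : H -> H -> H).
Proof. by move=> f g h; apply: linear_ext => x /=; rewrite addrA. Qed.
Fact homA_addC : commutative (homA_add : H -> H -> H).
Proof. by move=> f g; apply: linear_ext => x /=; rewrite addrC. Qed.
Fact homA_add0 : left_id homA_zero (homA_add : H -> H -> H).
Proof. by move=> f; apply: linear_ext => x /=; rewrite add0r. Qed.
Fact homA_addN :
  left_inverse homA_zero (homA_opp : H -> H) (homA_add : H -> H -> H).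
Proof. by move=> f; apply: linear_ext => x /=; rewrite addNr. Qed.

HB.instance Definition _ :=
  GRing.isZmodule.Build H homA_addA homA_addC homA_add0 homA_addN.

Definition homA_scale_fun (c : k) (f : {linear U -> V}) (u : U) : V :=
  c *: (f u : restr V).

Fact homA_scale_linear c f : linear (homA_scale_fun c f).
Proof.
move=> a u v; rewrite /homA_scale_fun !restr_scaleE linearP scalerDr.
by rewrite !scalerA kalg_central.
Qed.

HB.instance Definition _ c f :=
  GRing.isLinear.Build A U V *:%R (homA_scale_fun c f) (homA_scale_linear c f).

Definition homA_scale (c : k) (f : H) : H :=
  (homA_scale_fun c f) : {linear U -> V}.

Fact homA_scaleA a b f :
  homA_scale a (homA_scale b f) = homA_scale (a * b) f.
Proof. by apply: linear_ext => x; exact: (@scalerA k (restr V)). Qed.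
Fact homA_scale1 : left_id 1 homA_scale.
Proof. by move=> f; apply: linear_ext => x; exact: (@scale1r k (restr V)). Qed.
Fact homA_scaleDr : right_distributive homA_scale +%R.
Proof. by move=> a f g; apply: linear_ext => x; exact: (@scalerDr k (restr V)). Qed.
Fact homA_scaleDl f : {morph homA_scale^~ f : a b / a + b}.
Proof. by move=> a b; apply: linear_ext => x; exact: (@scalerDl k (restr V)). Qed.

HB.instance Definition _ := GRing.Zmodule_isLmodule.Build k H
  homA_scaleA homA_scale1 homA_scaleDr homA_scaleDl.

Lemma homA_addE (f g : H) x :
  (f + g : {linear U -> V}) x = (f : {linear _ -> _}) x + (g : {linear _ -> _}) x.
Proof. by []. Qed.

Lemma homA_scaleE (c : k) (f : H) x :
  (c *: f : {linear U -> V}) x = c *: ((f : {linear _ -> _}) x : restr V).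
Proof. by []. Qed.

End HomA.

Section LmodQuotient.
Variables (k : fieldType) (V : lmodType k) (W : submodClosed V).

Definition submod_pred : {pred V} := W.

Fact submod_pred_closed : zmod_closed submod_pred.
Proof. exact: GRing.submod_closedB (submodClosedP W). Qed.
HB.instance Definition _ := GRing.isZmodClosed.Build V submod_pred
  submod_pred_closed.

Definition lquot : Type := Quotient.quot submod_pred.
Local Notation Q := lquot.

HB.instance Definition _ := GRing.Zmodule.on Q.

Definition lquot_proj (v : V) : Q := \pi_(Quotient.quot submod_pred) v.

Lemma lquot_projD : {morph lquot_proj : u v / u + v}.
Proof. by move=> u v; exact: Quotient.pi_add. Qed.

Lemma lquot_projP u v : (lquot_proj u = lquot_proj v) <-> (u - v \in W).
Proof.
rewrite -[_ \in W]/(u - v \in submod_pred) Quotient.idealrBE.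
by split=> /eqP.
Qed.

Lemma lquot_projK (q : Q) : exists v, q = lquot_proj v.
Proof. by exists (repr (q : Quotient.quot submod_pred)); rewrite /lquot_proj reprK. Qed.

Definition lquot_scale (c : k) (q : Q) : Q :=
  lquot_proj (c *: repr (q : Quotient.quot submod_pred)).

Lemma lquot_scale_proj c v : lquot_scale c (lquot_proj v) = lquot_proj (c *: v).
Proof.
apply/lquot_projP; rewrite -scalerBr rpredZ //; apply/lquot_projP.
by rewrite /lquot_proj reprK.
Qed.

Fact lquot_scaleA a b q : lquot_scale a (lquot_scale b q) = lquot_scale (a * b) q.
Proof. by have [v ->] := lquot_projK q; rewrite !lquot_scale_proj scalerA. Qed.
Fact lquot_scale1 : left_id 1 lquot_scale.
Proof.
by move=> q; have [v ->] := lquot_projK q; rewrite lquot_scale_proj scale1r.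
Qed.
Fact lquot_scaleDr : right_distributive lquot_scale +%R.
Proof.
move=> a p q; have [u ->] := lquot_projK p; have [v ->] := lquot_projK q.
by rewrite -lquot_projD !lquot_scale_proj -lquot_projD scalerDr.
Qed.
Fact lquot_scaleDl q : {morph lquot_scale^~ q : a b / a + b}.
Proof.
move=> a b; have [v ->] := lquot_projK q.
by rewrite !lquot_scale_proj -lquot_projD scalerDl.
Qed.

HB.instance Definition _ := GRing.Zmodule_isLmodule.Build k Q
  lquot_scaleA lquot_scale1 lquot_scaleDr lquot_scaleDl.

Fact lquot_proj_linear : linear lquot_proj.
Proof. by move=> a u v; rewrite lquot_projD -lquot_scale_proj. Qed.

HB.instance Definition _ :=
  GRing.isLinear.Build k V Q *:%R lquot_proj lquot_proj_linear.

End LmodQuotient.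

Record cochain_complex (k : fieldType) := CochainComplex {
  cochain :> nat -> lmodType k;
  cdiff : forall n, {linear cochain n -> cochain n.+1};
  cdiff_cdiff : forall n x, cdiff n.+1 (cdiff n x) = 0
}.

Section Cohomology.
Variables (k : fieldType) (C : cochain_complex k).

(* In degree 0 the complex is extended by 0 to the left. *)
Definition in_coboundary (n : nat) : C n -> Prop :=
  match n return C n -> Prop with
  | 0 => fun x => x = 0
  | m.+1 => fun x => exists y : C m, x = cdiff C m y
  end.

Fact in_coboundary0 n : in_coboundary (0 : C n).
Proof. by case: n => //= m; exists 0; rewrite linear0. Qed.

Fact in_coboundary_linear n a (u v : C n) :
  in_coboundary u -> in_coboundary v -> in_coboundary (a *: u + v).
Proof.
case: n u v => /= [u v -> ->|m u v [u' ->] [v' ->]].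
  by rewrite scaler0 addr0.
by exists (a *: u' + v'); rewrite linearP.
Qed.

Variable n : nat.

Definition is_cocycle : {pred C n} := [pred x | cdiff C n x == 0].

Fact is_cocycle_submod : submod_closed is_cocycle.
Proof.
split=> [|a u v]; rewrite !inE ?linear0 // => /eqP u0 /eqP v0.
by rewrite linearP u0 v0 scaler0 addr0.
Qed.
HB.instance Definition _ :=
  GRing.isSubmodClosed.Build k (C n) is_cocycle is_cocycle_submod.

Record cocycle := Cocycle { cocycle_val :> C n; _ : cocycle_val \in is_cocycle }.
HB.instance Definition _ := [isSub for cocycle_val].
HB.instance Definition _ := [Choice of cocycle by <:].
HB.instance Definition _ := [SubChoice_isSubLmodule of cocycle by <:].

Definition is_coboundary : {pred cocycle} :=
  [pred z | `[< in_coboundary (val z) >]].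

Fact is_coboundary_submod : submod_closed is_coboundary.
Proof.
split=> [|a u v]; rewrite !inE.
  by apply/asboolP; rewrite linear0; exact: in_coboundary0.
move=> /asboolP Bu /asboolP Bv; apply/asboolP.
by rewrite linearP; exact: in_coboundary_linear.
Qed.
HB.instance Definition _ :=
  GRing.isSubmodClosed.Build k cocycle is_coboundary is_coboundary_submod.

Definition cohomology : lmodType k := lquot is_coboundary.

End Cohomology.

(* The bounds in each identity keep every inord in range. *)
Record simplicial_identities (X : nat -> Type)
    (d : forall n, 'I_n.+2 -> X n.+1 -> X n)
    (s : forall n, 'I_n.+1 -> X n -> X n.+1) : Prop := SimplicialIdentities {
  face_face : forall n (i j : nat) (x : X n.+2), (i < j <= n.+2)%N ->
    d n (inord i) (d n.+1 (inord j) x) = d n (inord j.-1) (d n.+1 (inord i) x);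
  degen_degen : forall n (i j : nat) (x : X n), (i <= j <= n)%N ->
    s n.+1 (inord i) (s n (inord j) x) = s n.+1 (inord j.+1) (s n (inord i) x);
  face_degen_lt : forall n (i j : nat) (x : X n.+1), (i < j <= n.+1)%N ->
    d n.+1 (inord i) (s n.+1 (inord j) x) = s n (inord j.-1) (d n (inord i) x);
  face_degen_eq : forall n (j : nat) (x : X n), (j <= n)%N ->
    d n (inord j) (s n (inord j) x) = x;
  face_degen_succ : forall n (j : nat) (x : X n), (j <= n)%N ->
    d n (inord j.+1) (s n (inord j) x) = x;
  face_degen_gt : forall n (i j : nat) (x : X n.+1), (j.+1 < i <= n.+2)%N ->
    d n.+1 (inord i) (s n.+1 (inord j) x) = s n (inord j) (d n (inord i.-1) x)
}.

Record cosimplicial_identities (X : nat -> Type)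
    (d : forall n, 'I_n.+2 -> X n -> X n.+1)
    (s : forall n, 'I_n.+1 -> X n.+1 -> X n) : Prop := CosimplicialIdentities {
  coface_coface : forall n (i j : nat) (x : X n), (i < j <= n.+2)%N ->
    d n.+1 (inord j) (d n (inord i) x) = d n.+1 (inord i) (d n (inord j.-1) x);
  codegen_codegen : forall n (i j : nat) (x : X n.+2), (i <= j <= n)%N ->
    s n (inord j) (s n.+1 (inord i) x) = s n (inord i) (s n.+1 (inord j.+1) x);
  codegen_coface_lt : forall n (i j : nat) (x : X n.+1), (i < j <= n.+1)%N ->
    s n.+1 (inord j) (d n.+1 (inord i) x) = d n (inord i) (s n (inord j.-1) x);
  codegen_coface_eq : forall n (j : nat) (x : X n), (j <= n)%N ->
    s n (inord j) (d n (inord j) x) = x;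
  codegen_coface_succ : forall n (j : nat) (x : X n), (j <= n)%N ->
    s n (inord j) (d n (inord j.+1) x) = x;
  codegen_coface_gt : forall n (i j : nat) (x : X n.+1), (j.+1 < i <= n.+2)%N ->
    s n.+1 (inord j) (d n.+1 (inord i) x) = d n (inord i.-1) (s n (inord j) x)
}.

Record cosimplicial_vect (k : fieldType) := CosimplicialVect {
  csv :> nat -> lmodType k;
  csv_coface : forall n, 'I_n.+2 -> {linear csv n -> csv n.+1};
  csv_codegen : forall n, 'I_n.+1 -> {linear csv n.+1 -> csv n};
  csv_identities : cosimplicial_identities
    (fun n i => csv_coface i : csv n -> csv n.+1)
    (fun n i => csv_codegen i : csv n.+1 -> csv n)
}.

Section AssociatedComplex.
Variables (k : fieldType) (X : cosimplicial_vect k).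

Definition csv_diff n (x : X n) : X n.+1 :=
  \sum_(i < n.+2) (-1) ^+ i *: csv_coface X i x.

Fact csv_diff_linear n : linear (@csv_diff n).
Proof.
move=> a u v; rewrite /csv_diff scaler_sumr -big_split /=.
apply: eq_bigr => i _; rewrite linearP scalerDr !scalerA.
by rewrite [a * _]mulrC.
Qed.

HB.instance Definition _ n :=
  GRing.isLinear.Build k (X n) (X n.+1) *:%R (@csv_diff n) (@csv_diff_linear n).

Fact csv_diff_diff n (x : X n) : csv_diff (csv_diff x) = 0.
Proof.
pose F (p : 'I_n.+3 * 'I_n.+2) : X n.+2 :=
  (-1) ^+ (p.1 + p.2) *: csv_coface X p.1 (csv_coface X p.2 x).
have -> : csv_diff (csv_diff x) = \sum_p F p.
  rewrite -(pair_big xpredT xpredT (fun j i => F (j, i))) /=.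
  apply: eq_bigr => j _; rewrite linear_sum scaler_sumr; apply: eq_bigr => i _.
  by rewrite linearZ scalerA -exprD.
pose P (p : 'I_n.+3 * 'I_n.+2) := (p.2 < p.1)%N.
pose h (p : 'I_n.+3 * 'I_n.+2) : 'I_n.+3 * 'I_n.+2 := (inord p.2.+1, inord p.1).
pose h' (p : 'I_n.+3 * 'I_n.+2) : 'I_n.+3 * 'I_n.+2 := (inord p.2, inord p.1.-1).
have hK p : P p -> h (h' p) = p.
  case: p => j i; rewrite /P /h /h' /= => ij.
  have jn := ltn_ord j; have ni := ltn_ord i.
  have j0 : (0 < j)%N by apply: leq_ltn_trans ij.
  have jn' : (j.-1 < n.+2)%N by rewrite -ltnS prednK.
  have ni' : (i < n.+3)%N by apply: ltnW.
  congr (_, _); apply: val_inj; rewrite /= inordK //= inordK //=.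
  by rewrite prednK.
have PhE p : P (h p) && (h' (h p) == p) = ~~ P p.
  case: p => a b; rewrite /P /h /h' /= -leqNgt.
  have an := ltn_ord a; have bn := ltn_ord b.
  have bn1 : (b.+1 < n.+3)%N by [].
  rewrite (inordK bn1) /= ltnS -pair_eqE /pair_eq /= -!val_eqE /=.
  rewrite (inordK bn) eqxx andbT.
  case: (ltnP a n.+2) => an2.
    by rewrite !inordK // eqxx andbT.
  have -> : (a <= b)%N = false.
    by apply/negbTE; rewrite -ltnNge; apply: leq_trans an2.
  apply/negbTE/negP => /andP[_ /eqP aE]; move: an2; rewrite leqNgt => /negP; apply.
  have lt := ltn_ord (inord a : 'I_n.+2).
  by rewrite -[X in (X < _)%N]aE inordK //; apply: ltnW.
rewrite (bigID P) /= (reindex_onto h h' hK) (eq_bigl _ _ PhE).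
rewrite -big_split big1 // => -[a b]; rewrite /P /F /h -leqNgt /= => ab.
have an : (a < n.+2)%N by apply: leq_ltn_trans ab _.
have bn1 : (b.+1 < n.+3)%N by rewrite !ltnS -ltnS.
rewrite !inordK // (coface_coface (csv_identities X)) /=; last first.
  by rewrite !ltnS ab -ltnS /=.
rewrite !inord_val addSn exprS addnC mulN1r scaleNr.
by rewrite addNr.
Qed.

Definition associated_complex : cochain_complex k :=
  CochainComplex (cdiff := fun n => @csv_diff n : {linear X n -> X n.+1})
    csv_diff_diff.

End AssociatedComplex.

Record simplicial_algebra (k : fieldType) := SimplicialAlgebra {
  salg :> nat -> kalgebra k;
  salg_face : forall n, 'I_n.+2 -> kalg_morphism (salg n.+1) (salg n);
  salg_degen : forall n, 'I_n.+1 -> kalg_morphism (salg n) (salg n.+1);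
  salg_identities : simplicial_identities
    (fun n i => salg_face i : salg n.+1 -> salg n)
    (fun n i => salg_degen i : salg n -> salg n.+1)
}.

Record simplicial_module (k : fieldType) (A : simplicial_algebra k) :=
  SimplicialModule {
  smod :> forall n, lmodType (A n);
  smod_face : forall n, 'I_n.+2 ->
    {linear restr (smod n.+1) -> restr (smod n)};
  smod_degen : forall n, 'I_n.+1 ->
    {linear restr (smod n) -> restr (smod n.+1)};
  smod_identities : simplicial_identities
    (fun n i => smod_face i : smod n.+1 -> smod n)
    (fun n i => smod_degen i : smod n -> smod n.+1);
  smod_face_act : forall n (i : 'I_n.+2) (a : A n.+1) (b : smod n.+1),
    smod_face i (a *: b) = salg_face A i a *: (smod_face i b : smod n);
  smod_degen_act : forall n (i : 'I_n.+1) (a : A n) (b : smod n),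
    smod_degen i (a *: b) = salg_degen A i a *: (smod_degen i b : smod n.+1)
}.

Record cosimplicial_module (k : fieldType) (A : simplicial_algebra k) :=
  CosimplicialModule {
  csmod :> forall n, lmodType (A n);
  csmod_coface : forall n, 'I_n.+2 ->
    {linear restr (csmod n) -> restr (csmod n.+1)};
  csmod_codegen : forall n, 'I_n.+1 ->
    {linear restr (csmod n.+1) -> restr (csmod n)};
  csmod_identities : cosimplicial_identities
    (fun n i => csmod_coface i : csmod n -> csmod n.+1)
    (fun n i => csmod_codegen i : csmod n.+1 -> csmod n);
  csmod_coface_act : forall n (i : 'I_n.+2) (a : A n.+1) (m : csmod n),
    csmod_coface i (salg_face A i a *: m) =
      a *: (csmod_coface i m : csmod n.+1);
  csmod_codegen_act : forall n (i : 'I_n.+1) (a : A n) (m : csmod n.+1),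
    csmod_codegen i (salg_degen A i a *: m) =
      a *: (csmod_codegen i m : csmod n)
}.

Section HomCosimplicial.
Variables (k : fieldType) (A : simplicial_algebra k).
Variables (B : simplicial_module A) (M : cosimplicial_module A).

Definition hom_coface_fun n (i : 'I_n.+2) (phi : {linear B n -> M n}) :
    B n.+1 -> M n.+1 :=
  fun b => csmod_coface M i (phi (smod_face B i b)).

Fact hom_coface_fun_linear n (i : 'I_n.+2) phi :
  linear (@hom_coface_fun n i phi).
Proof.
move=> a u v; rewrite /hom_coface_fun [smod_face B i _]linearD smod_face_act.
by rewrite [phi _]linearP [csmod_coface M i _]linearD csmod_coface_act.
Qed.
HB.instance Definition _ n i phi := GRing.isLinear.Build
  (A n.+1) (B n.+1) (M n.+1) *:%R (@hom_coface_fun n i phi)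
  (@hom_coface_fun_linear n i phi).

Definition hom_coface n (i : 'I_n.+2) (phi : homA (B n) (M n)) :
  homA (B n.+1) (M n.+1) := hom_coface_fun i phi : {linear B n.+1 -> M n.+1}.

Definition hom_codegen_fun n (i : 'I_n.+1) (phi : {linear B n.+1 -> M n.+1}) :
    B n -> M n :=
  fun b => csmod_codegen M i (phi (smod_degen B i b)).

Fact hom_codegen_fun_linear n (i : 'I_n.+1) phi :
  linear (@hom_codegen_fun n i phi).
Proof.
move=> a u v; rewrite /hom_codegen_fun [smod_degen B i _]linearD smod_degen_act.
by rewrite [phi _]linearP [csmod_codegen M i _]linearD csmod_codegen_act.
Qed.
HB.instance Definition _ n i phi := GRing.isLinear.Build
  (A n) (B n) (M n) *:%R (@hom_codegen_fun n i phi)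
  (@hom_codegen_fun_linear n i phi).

Definition hom_codegen n (i : 'I_n.+1) (phi : homA (B n.+1) (M n.+1)) :
  homA (B n) (M n) := hom_codegen_fun i phi : {linear B n -> M n}.

Fact hom_coface_linear n (i : 'I_n.+2) : linear (@hom_coface n i).
Proof.
by move=> c f g; apply: linear_ext => b; exact: (linearP (csmod_coface M i)).
Qed.
HB.instance Definition _ n i := GRing.isLinear.Build k
  (homA (B n) (M n)) (homA (B n.+1) (M n.+1)) *:%R
  (@hom_coface n i) (@hom_coface_linear n i).

Fact hom_codegen_linear n (i : 'I_n.+1) : linear (@hom_codegen n i).
Proof.
by move=> c f g; apply: linear_ext => b; exact: (linearP (csmod_codegen M i)).
Qed.
HB.instance Definition _ n i := GRing.isLinear.Build k
  (homA (B n.+1) (M n.+1)) (homA (B n) (M n)) *:%R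
  (@hom_codegen n i) (@hom_codegen_linear n i).

Fact hom_identities : cosimplicial_identities
  (X := fun n => homA (B n) (M n)) hom_coface hom_codegen.
Proof.
have MI := csmod_identities M; have BI := smod_identities B.
split=> [n i j f ij|n i j f ij|n i j f ij|n j f jn|n j f jn|n i j f ij];
  apply: linear_ext => b;
  rewrite /hom_coface /hom_codegen /= /hom_coface_fun /hom_codegen_fun /=.
- by rewrite (coface_coface MI) // (face_face BI).
- by rewrite (codegen_codegen MI) // (degen_degen BI).
- by rewrite (codegen_coface_lt MI) // (face_degen_lt BI).
- by rewrite (codegen_coface_eq MI) // (face_degen_eq BI).
- by rewrite (codegen_coface_succ MI) // (face_degen_succ BI).
- by rewrite (codegen_coface_gt MI) // (face_degen_gt BI).
Qed.

Definition hom_cosimplicial : cosimplicial_vect k :=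
  @CosimplicialVect k (fun n => homA (B n) (M n))
    (fun n i => @hom_coface n i : {linear _ -> _})
    (fun n i => @hom_codegen n i : {linear _ -> _}) hom_identities.

End HomCosimplicial.

Record presimplicial_morphism (k : fieldType) (A : simplicial_algebra k)
    (B C : simplicial_module A) := PresimplicialMorphism {
  psm_map :> forall n, {linear B n -> C n};
  psm_face : forall n (i : 'I_n.+2) (b : B n.+1),
    psm_map n (smod_face B i b) = smod_face C i (psm_map n.+1 b)
}.

Section PresimplicialMorphisms.
Variables (k : fieldType) (A : simplicial_algebra k).

Definition psm_id (B : simplicial_module A) : presimplicial_morphism B B :=
  @PresimplicialMorphism k A B B (fun n => idfun : {linear B n -> B n})
    (fun n i b => erefl).

Fact psm_comp_face (B C D : simplicial_module A)
    (g : presimplicial_morphism C D) (f : presimplicial_morphism B C)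
    n (i : 'I_n.+2) (b : B n.+1) :
  (g n \o f n) (smod_face B i b) = smod_face D i ((g n.+1 \o f n.+1) b).
Proof. by rewrite /= !psm_face. Qed.

Definition psm_comp (B C D : simplicial_module A)
    (g : presimplicial_morphism C D) (f : presimplicial_morphism B C) :
    presimplicial_morphism B D :=
  @PresimplicialMorphism k A B D
    (fun n => (g n \o f n) : {linear B n -> D n}) (psm_comp_face g f).

Record presimplicial_homotopy (B C : simplicial_module A)
    (f g : presimplicial_morphism B C) := PresimplicialHomotopy {
  psh_map : forall n, 'I_n.+1 -> {linear restr (B n) -> restr (C n.+1)};
  psh_act : forall n (i : 'I_n.+1) (a : A n) (b : B n),
    psh_map i (a *: b) = salg_degen A i a *: (psh_map i b : C n.+1);
  psh_face_lt : forall n (i j : nat) (b : B n.+1), (i < j <= n.+1)%N ->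
    smod_face C (inord i : 'I_n.+3) (psh_map (inord j : 'I_n.+2) b) =
      psh_map (inord j.-1 : 'I_n.+1) (smod_face B (inord i : 'I_n.+2) b);
  psh_face_eq : forall n (i : nat) (b : B n), (0 < i <= n)%N ->
    smod_face C (inord i : 'I_n.+2) (psh_map (inord i : 'I_n.+1) b) =
      smod_face C (inord i : 'I_n.+2) (psh_map (inord i.-1 : 'I_n.+1) b);
  psh_face_gt : forall n (i j : nat) (b : B n.+1), (j.+1 < i <= n.+2)%N ->
    smod_face C (inord i : 'I_n.+3) (psh_map (inord j : 'I_n.+2) b) =
      psh_map (inord j : 'I_n.+1) (smod_face B (inord i.-1 : 'I_n.+2) b);
  psh_face_first : forall n (b : B n),
    smod_face C (ord0 : 'I_n.+2) (psh_map (ord0 : 'I_n.+1) b) = f n b;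
  psh_face_last : forall n (b : B n),
    smod_face C (ord_max : 'I_n.+2) (psh_map (ord_max : 'I_n.+1) b) = g n b
}.

Definition presimplicial_homotopy_equivalence (B C : simplicial_module A)
    (f : presimplicial_morphism B C) : Prop :=
  exists g : presimplicial_morphism C B,
    inhabited (presimplicial_homotopy (psm_comp g f) (psm_id B)) /\
    inhabited (presimplicial_homotopy (psm_comp f g) (psm_id C)).

End PresimplicialMorphisms.

Definition lmod_iso (k : fieldType) (U V : lmodType k) : Prop :=
  exists phi : {linear U -> V}, bijective phi.

(* Main.v *)
Require Import Defs.
From mathcomp Require Import all_boot all_algebra.
From HB Require Import structures.
From mathcomp Require Import ring_quotient boolp.

(** A presimplicial homotopy [h] between [f, g : B -> C] dualizes.  The maps
    [phi |-> sigma^j \o phi \o h_j] send Hom(C_(n+1), M^(n+1)) to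
    Hom(B_n, M^n): the codegeneracy of M absorbs the twist
    [h_j (a b) = sigma_j(a) h_j(b)], so the result is again linear over A_n.
    Pairing each relation between the faces of C and [h] with the relation
    between the cofaces and codegeneracies of M of the same indices, one gets
    the axioms of a cosimplicial homotopy between the pullbacks [f^*] and [g^*]
    ([pullback_homotopy]).  On the diagonals, [sigma^j delta^j] and
    [sigma^j delta^(j+1)] are identities, so M drops out and the corresponding
    relations of [h] are passed on unchanged.

    The alternating sum K of a cosimplicial homotopy satisfies
    [K d + d K = f^* - g^*] ([homotopy_sum]), so [f^*] and [g^*] differ by a
    coboundary on cocycles ([cosimplicial_homotopy_cohomologous]).  For an
    equivalence [f] with inverse [g], both [f^* g^* = (g f)^*] and
    [g^* f^* = (f g)^*] are thus the identity up to coboundaries, and a pair of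
    cochain maps with this property induces mutually inverse maps in cohomology
    ([cohomology_iso]). *)

Set Implicit Arguments.
Unset Strict Implicit.
Unset Printing Implicit Defensive.

Import GRing.Theory.
Local Open Scope ring_scope.

(** * Maps that are inverse up to coboundaries *)

Section QuotientMap.
Variables (k : fieldType) (V W : lmodType k).
Variables (P : submodClosed V) (Q : submodClosed W) (u : {linear V -> W}).
Hypothesis uPQ : forall x, x \in P -> u x \in Q.

Definition lquot_map (q : lquot P) : lquot Q :=
  lquot_proj Q (u (repr (q : Quotient.quot (submod_pred P)))).

Lemma lquot_map_proj x : lquot_map (lquot_proj P x) = lquot_proj Q (u x).
Proof.
apply/lquot_projP; rewrite -linearB; apply: uPQ; apply/lquot_projP.
by rewrite /lquot_proj reprK.
Qed.

Lemma lquot_map_linear : linear lquot_map.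
Proof.
move=> a p q; have [x ->] := lquot_projK p; have [y ->] := lquot_projK q.
by rewrite -linearP !lquot_map_proj linearP linearP.
Qed.

End QuotientMap.

(** Asking for inverses only modulo [P] and [Q] is what makes this apply to maps
    of cocycles that are inverse up to coboundaries. *)
Lemma lquot_iso (k : fieldType) (V W : lmodType k)
    (P : submodClosed V) (Q : submodClosed W)
    (u : {linear V -> W}) (v : {linear W -> V}) :
  (forall x, x \in P -> u x \in Q) -> (forall y, y \in Q -> v y \in P) ->
  (forall x, v (u x) - x \in P) -> (forall y, u (v y) - y \in Q) ->
  lmod_iso (lquot P) (lquot Q).
Proof.
move=> uPQ vQP vu uv.
pose m := GRing.isLinear.Build k (lquot P) (lquot Q) *:%R _ (lquot_map_linear uPQ).
pose phi : {linear lquot P -> lquot Q} := HB.pack (lquot_map Q u) m.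
exists phi; exists (lquot_map P v) => q; have [x ->] := lquot_projK q.
  by rewrite /= !lquot_map_proj //; apply/lquot_projP.
by rewrite /= !lquot_map_proj //; apply/lquot_projP.
Qed.

Lemma cdiff_cocycle (k : fieldType) (C : cochain_complex k) n (z : cocycle C n) :
  cdiff C n (val z) = 0.
Proof. by apply/eqP; have := valP z; rewrite inE. Qed.

Section CocycleMap.
Variables (k : fieldType) (C D : cochain_complex k).
Variable f : forall n, {linear C n -> D n}.
Hypothesis fd : forall n (x : C n), f n.+1 (cdiff C n x) = cdiff D n (f n x).

Lemma cocycle_map_subproof n (z : cocycle C n) : f n (val z) \in is_cocycle (n := n).
Proof.
by rewrite inE /= -fd cdiff_cocycle linear0.
Qed.

Definition cocycle_map n (z : cocycle C n) : cocycle D n :=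
  Cocycle (cocycle_map_subproof z).

Lemma cocycle_map_linear n : linear (@cocycle_map n).
Proof. by move=> a x y; apply: val_inj; rewrite /= !linearP. Qed.

HB.instance Definition _ n := GRing.isLinear.Build k (cocycle C n) (cocycle D n)
  *:%R (@cocycle_map n) (@cocycle_map_linear n).

Lemma cocycle_map_coboundary n (z : cocycle C n) :
  z \in is_coboundary (n := n) -> cocycle_map z \in is_coboundary (n := n).
Proof.
rewrite !inE => /asboolP Bz; apply/asboolP; move: Bz => /=.
move: (cocycle_val z) => {z} x.
case: n x => [x -> | n x [y ->]] /=; first by rewrite linear0.
by exists (f n y); rewrite fd.
Qed.

End CocycleMap.

(** The two conditions are imposed on cocycles alone, which is where a homotopy
    [K d + d K] reduces to a coboundary. *)
Lemma cohomology_iso (k : fieldType) (C D : cochain_complex k)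
    (f : forall n, {linear C n -> D n}) (g : forall n, {linear D n -> C n}) :
  (forall n x, f n.+1 (cdiff C n x) = cdiff D n (f n x)) ->
  (forall n x, g n.+1 (cdiff D n x) = cdiff C n (g n x)) ->
  (forall n x, cdiff C n x = 0 -> in_coboundary (g n (f n x) - x)) ->
  (forall n y, cdiff D n y = 0 -> in_coboundary (f n (g n y) - y)) ->
  forall n, lmod_iso (cohomology C n) (cohomology D n).
Proof.
move=> fd gd gf fg n.
apply: (@lquot_iso _ _ _ _ _ (@cocycle_map _ _ _ _ fd n) (@cocycle_map _ _ _ _ gd n)).
- exact: cocycle_map_coboundary.
- exact: cocycle_map_coboundary.
- by move=> z; rewrite inE; apply/asboolP; apply: gf; exact: cdiff_cocycle.
- by move=> z; rewrite inE; apply/asboolP; apply: fg; exact: cdiff_cocycle.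
Qed.

(** * Cosimplicial homotopies *)

(** The cancellation behind [K d + d K = F - G], with [a j i] standing for
    [H^j D^i x] and [b i j] for [D^i H^j x].  Off the diagonals [i = j] and
    [i = j + 1] each term of the first sum is, by a shift of one index and hence
    with the opposite sign, a term of the second; the diagonals telescope. *)
Lemma homotopy_sum (k : pzRingType) (V : lmodType k) (n : nat)
    (a b : nat -> nat -> V) :
  (forall i j, (i < j <= n)%N -> a j i = b i j.-1) ->
  (forall i j, (j.+1 < i <= n.+1)%N -> a j i = b i.-1 j) ->
  (forall i, (0 < i <= n)%N -> a i i = a i.-1 i) ->
  \sum_(0 <= j < n.+1) \sum_(0 <= i < n.+2) (-1) ^+ (i + j) *: a j i
    + \sum_(0 <= i < n.+1) \sum_(0 <= j < n) (-1) ^+ (i + j) *: b i j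
  = a 0 0 - a n n.+1.
Proof.
move=> alt agt aeq.
pose e i j := (-1) ^+ (i + j) *: b i j.
(* Row j is cut into the part i < j, the entries i = j and i = j + 1, whose signs
   are 1 and -1, and the part i > j + 1, where i is shifted down by one. *)
have split_row j : (j < n.+1)%N ->
    \sum_(0 <= i < n.+2) (-1) ^+ (i + j) *: a j i
    = - (\sum_(0 <= i < j) e i j.-1) - (\sum_(j.+1 <= i < n.+1) e i j)
      + (a j j - a j j.+1).
  move=> jn; rewrite (@big_cat_nat _ _ _ j) //=; last exact: (leq_trans (ltnW jn)).
  rewrite (@big_ltn _ _ _ j); last exact: (leq_trans jn).
  rewrite (@big_ltn _ _ _ j.+1) // big_add1 /= -!sumrN.
  rewrite (_ : \sum_(0 <= i < j) _ = \sum_(0 <= i < j) - e i j.-1); last first.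
    apply: eq_big_nat => i /= ij; rewrite alt ?ij //.
    by case: j jn ij => // j _ _; rewrite /e addnS exprS mulN1r scaleNr.
  rewrite (_ : \sum_(j.+1 <= i < n.+1) _ = \sum_(j.+1 <= i < n.+1) - e i j).
    rewrite addnn -signr_odd odd_double scale1r addSn addnn exprS -signr_odd odd_double.
    by rewrite mulr1 scaleN1r -!addrA; congr (_ + _); rewrite addrC -addrA addrC addrA.
  apply: eq_big_nat => i /andP[ji ni]; rewrite agt ?ltnS ?ji //=.
  by rewrite /e addSn exprS mulN1r scaleNr.
rewrite (eq_big_nat _ _ (F2 := fun j =>
  - (\sum_(0 <= i < j) e i j.-1) - (\sum_(j.+1 <= i < n.+1) e i j)
      + (a j j - a j j.+1))); last by move=> j /andP[_]; exact: split_row.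
rewrite !big_split /= !sumrN.
(* Row j = 0 has no entry with i < j and row j = n none with i > j + 1. *)
rewrite [X in - X - _]big_nat_recl //= [X in - (X + _) - _]big_geq // add0r.
rewrite [X in _ - X]big_nat_recr //= [X in _ - (_ + X)]big_geq // addr0.
rewrite -opprD -big_split /=.
have -> : \sum_(0 <= j < n.+1) a j j - \sum_(0 <= j < n.+1) a j j.+1
    = a 0 0 - a n n.+1.
  rewrite big_nat_recl // big_nat_recr //= opprD addrA -[a 0 0 + _ - _]addrA.
  rewrite (eq_big_nat _ _ (F2 := fun j => a j j.+1)) ?subrr ?addr0 //.
  by move=> j /andP[_ jn]; rewrite (aeq j.+1).
rewrite (eq_big_nat _ _ (F2 := fun j => \sum_(0 <= i < n.+1) e i j)); last first.
  move=> j /andP[_ jn]; rewrite [RHS](@big_cat_nat _ _ _ j.+1) //=.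
  exact: leqW.
by rewrite exchange_big_nat /= addrAC addNr add0r.
Qed.

(** The dual of a presimplicial homotopy: [csh_map] lowers the degree by one and
    is related to the cofaces only. *)
Record cosimplicial_homotopy (k : fieldType) (X Y : cosimplicial_vect k)
    (F G : forall n, X n -> Y n) := CosimplicialHomotopy {
  csh_map : forall n, 'I_n.+1 -> {linear X n.+1 -> Y n};
  csh_coface_lt : forall n (i j : nat) (x : X n.+1), (i < j <= n.+1)%N ->
    csh_map (inord j : 'I_n.+2) (csv_coface X (inord i) x) =
      csv_coface Y (inord i) (csh_map (inord j.-1 : 'I_n.+1) x);
  csh_coface_gt : forall n (i j : nat) (x : X n.+1), (j.+1 < i <= n.+2)%N ->
    csh_map (inord j : 'I_n.+2) (csv_coface X (inord i) x) =
      csv_coface Y (inord i.-1) (csh_map (inord j : 'I_n.+1) x);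
  csh_coface_eq : forall n (i : nat) (x : X n), (0 < i <= n)%N ->
    csh_map (inord i : 'I_n.+1) (csv_coface X (inord i) x) =
      csh_map (inord i.-1 : 'I_n.+1) (csv_coface X (inord i) x);
  csh_coface_first : forall n (x : X n),
    csh_map (ord0 : 'I_n.+1) (csv_coface X ord0 x) = F n x;
  csh_coface_last : forall n (x : X n),
    csh_map (ord_max : 'I_n.+1) (csv_coface X ord_max x) = G n x
}.

Lemma csv_diffE (k : fieldType) (X : cosimplicial_vect k) n (x : X n) :
  csv_diff x = \sum_(0 <= i < n.+2) (-1) ^+ i *: csv_coface X (inord i) x.
Proof.
by rewrite /csv_diff big_mkord; apply: eq_bigr => i _; rewrite inord_val.
Qed.

(** On a cocycle x the sum of [homotopy_sum] reduces to its second half, which is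
    the coboundary of [\sum_j (-1)^j H^j x]. *)
Lemma cosimplicial_homotopy_cohomologous (k : fieldType)
    (X Y : cosimplicial_vect k) (F G : forall n, X n -> Y n) :
  cosimplicial_homotopy F G ->
  forall n (x : associated_complex X n), cdiff (associated_complex X) n x = 0 ->
  @in_coboundary k (associated_complex Y) n (F n x - G n x).
Proof.
case=> H Hlt Hgt Heq Hfirst Hlast n x /= dx.
pose a j i := H n (inord j) (csv_coface X (inord i) x).
have FE : a 0 0 = F n x.
  rewrite -Hfirst /a; congr (H n _ (csv_coface X _ x));
    by apply: val_inj; rewrite /= inordK.
have GE : a n n.+1 = G n x.
  rewrite -Hlast /a; congr (H n _ (csv_coface X _ x));
    by apply: val_inj; rewrite /= inordK.
have Kd : \sum_(0 <= j < n.+1) \sum_(0 <= i < n.+2) (-1) ^+ (i + j) *: a j i = 0.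
  rewrite big1 // => j _.
  transitivity ((-1) ^+ j *: H n (inord j) (csv_diff x)).
    rewrite csv_diffE linear_sum scaler_sumr; apply: eq_bigr => i _.
    by rewrite linearZ scalerA -exprD addnC.
  by rewrite dx linear0 scaler0.
case: n x dx @a FE GE Kd => [|n] x dx a FE GE Kd /=.
  (* For n = 0 the second half of [homotopy_sum] is an empty sum, hence b := 0. *)
  rewrite -FE -GE -(@homotopy_sum k (Y 0) 0 a (fun _ _ => 0)).
  - by rewrite Kd add0r big1 // => i _; rewrite big_geq.
  - by move=> i j /andP[ij j0]; have := leq_trans ij j0.
  - by move=> i j /andP[ji i1]; have := leq_trans ji i1.
  - by move=> i /andP[i0 iz]; have := leq_trans i0 iz.
pose b i j := csv_coface Y (inord i) (H n (inord j) x).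
exists (\sum_(0 <= j < n.+1) (-1) ^+ j *: H n (inord j) x).
rewrite -FE -GE -(homotopy_sum (b := b)).
- rewrite Kd add0r csv_diffE; apply: eq_bigr => i _.
  rewrite linear_sum scaler_sumr; apply: eq_bigr => j _.
  by rewrite linearZ scalerA -exprD.
- by move=> i j ij; apply: Hlt.
- by move=> i j ij; apply: Hgt.
- by move=> i ij; apply: Heq.
Qed.

(** * Dualizing presimplicial morphisms and homotopies *)

Section Pullback.
Variables (k : fieldType) (A : simplicial_algebra k) (M : cosimplicial_module A).

Section Morphism.
Variables (B C : simplicial_module A) (f : presimplicial_morphism B C).

Definition pullback n (phi : homA (C n) (M n)) : homA (B n) (M n) :=
  ((phi : {linear C n -> M n}) \o f n) : {linear B n -> M n}.

Lemma pullback_linear n : linear (@pullback n).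
Proof. by move=> c phi psi; apply: linear_ext. Qed.

HB.instance Definition _ n := GRing.isLinear.Build k
  (homA (C n) (M n)) (homA (B n) (M n)) *:%R (@pullback n) (@pullback_linear n).

Lemma pullback_coface n (i : 'I_n.+2) (phi : homA (C n) (M n)) :
  pullback (hom_coface i phi) = hom_coface i (pullback phi).
Proof.
by apply: linear_ext => b; rewrite /= /hom_coface_fun /= -psm_face.
Qed.

Lemma pullback_diff n (phi : hom_cosimplicial C M n) :
  pullback (csv_diff phi) = csv_diff (pullback phi : hom_cosimplicial B M n).
Proof.
rewrite /csv_diff linear_sum; apply: eq_bigr => i _.
by rewrite linearZ; congr (_ *: _); exact: pullback_coface.
Qed.

End Morphism.

Section Homotopy.
Variables (B C : simplicial_module A) (f g : presimplicial_morphism B C).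
Variable h : presimplicial_homotopy f g.

(** [sigma^j (phi (h_j (a b))) = sigma^j (sigma_j(a) phi (h_j b))
    = a sigma^j (phi (h_j b))]: the codegeneracy is what restores linearity over
    A_n. *)
Definition pullback_htpy_fun n (j : 'I_n.+1) (phi : {linear C n.+1 -> M n.+1}) :
    B n -> M n :=
  fun b => csmod_codegen M j (phi (psh_map h j b)).

Lemma pullback_htpy_fun_linear n (j : 'I_n.+1) phi :
  linear (@pullback_htpy_fun n j phi).
Proof.
move=> a u v; rewrite /pullback_htpy_fun [psh_map h j _]linearD psh_act.
by rewrite [phi _]linearP [csmod_codegen M j _]linearD csmod_codegen_act.
Qed.
HB.instance Definition _ n j phi := GRing.isLinear.Build
  (A n) (B n) (M n) *:%R (@pullback_htpy_fun n j phi)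
  (@pullback_htpy_fun_linear n j phi).

Definition pullback_htpy n (j : 'I_n.+1) (phi : homA (C n.+1) (M n.+1)) :
  homA (B n) (M n) := pullback_htpy_fun j phi : {linear B n -> M n}.

Lemma pullback_htpy_linear n (j : 'I_n.+1) : linear (@pullback_htpy n j).
Proof.
by move=> c p q; apply: linear_ext => b; exact: (linearP (csmod_codegen M j)).
Qed.
HB.instance Definition _ n j := GRing.isLinear.Build k
  (homA (C n.+1) (M n.+1)) (homA (B n) (M n)) *:%R
  (@pullback_htpy n j) (@pullback_htpy_linear n j).

(** Each relation combines the coface-codegeneracy relation of M and the face
    relation of [h] for the same pair of indices. *)
Lemma pullback_homotopy : cosimplicial_homotopy
  (X := hom_cosimplicial C M) (Y := hom_cosimplicial B M)
  (@pullback B C f) (@pullback B C g).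
Proof.
have MI := csmod_identities M.
exists (fun n j => @pullback_htpy n j : {linear _ -> _});
  [move=> n i j phi ij|move=> n i j phi ij|move=> n i phi ij|move=> n phi|move=> n phi];
  apply: linear_ext => b;
  rewrite /= /pullback_htpy_fun /hom_coface_fun /= /pullback_htpy_fun /hom_coface_fun.
- by rewrite (codegen_coface_lt MI) // psh_face_lt.
- by rewrite (codegen_coface_gt MI) // psh_face_gt.
(* delta^i is cancelled by sigma^i on one side and by sigma^(i-1) on the other. *)
- case: i ij => // i ij /=.
  have /andP[_ lt_in] := ij.
  rewrite (codegen_coface_eq MI) // (codegen_coface_succ MI) //; last exact: ltnW.
  by rewrite psh_face_eq.
- rewrite -(psh_face_first h) -[RHS](codegen_coface_eq MI _ (leq0n n)).
  by congr (csmod_codegen M _ (csmod_coface M _ _));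
    apply: val_inj; rewrite /= inordK.
- rewrite -(psh_face_last h) -[RHS](codegen_coface_succ MI _ (leqnn n)).
  by congr (csmod_codegen M _ (csmod_coface M _ _));
    apply: val_inj; rewrite /= inordK.
Qed.

End Homotopy.
End Pullback.

(** * Homotopy invariance of the cohomology *)

Theorem proposition3p7 (k : fieldType) (A : simplicial_algebra k)
    (B C : simplicial_module A) (M : cosimplicial_module A) :
  (exists f : presimplicial_morphism B C, presimplicial_homotopy_equivalence f) ->
  forall n : nat,
    lmod_iso (cohomology (associated_complex (hom_cosimplicial B M)) n)
             (cohomology (associated_complex (hom_cosimplicial C M)) n).
Proof.
case=> f [g [[hB] [hC]]].
pose X := associated_complex (hom_cosimplicial B M).
pose Y := associated_complex (hom_cosimplicial C M).
(* Pulling back is contravariant: f induces G, and its inverse g induces F. *)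
pose F n : {linear X n -> Y n} := @pullback k A M C B g n.
pose G n : {linear Y n -> X n} := @pullback k A M B C f n.
apply: (@cohomology_iso k X Y F G) => n x.
- exact: pullback_diff.
- exact: pullback_diff.
- move=> dx; have := cosimplicial_homotopy_cohomologous (pullback_homotopy M hB) dx.
  by congr in_coboundary; congr (_ - _); exact: linear_ext.
- move=> dx; have := cosimplicial_homotopy_cohomologous (pullback_homotopy M hC) dx.
  by congr in_coboundary; congr (_ - _); exact: linear_ext.
Qed.
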